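(* Let $n\ge 2$ and let $A=[a_{ij}]$ be the $n\times n$ tridiagonal $(0,1)$-matrix with $a_{ij}=1$ if $|i-j|\le 1$ and $a_{ij}=0$ otherwise. For $x=(x_1,\ldots,x_{n-1})\in\mathbb{R}^{n-1}$ let $X(x)$ be the symmetric tridiagonal $n\times n$ matrix with entries $(i,i+1)$ and $(i+1,i)$ equal to $x_i$ ($1\le i\le n-1$), diagonal entries $(i,i)$ equal to $1-x_{i-1}-x_i$ ($1\le i\le n$, with the convention $x_0=x_n=0$), and all other entries $0$. Then the linear system \[ x_{i-1}+4x_i+x_{i+1}=2\quad (1\le i\le n-1),\qquad x_0=x_n=0, \] has a unique solution $x$; for this $x$, the matrix $X(x)$ is doubly stochastic with $\xi(X(x))=\xi(A)$ and all diagonals of $X(x)$ avoiding $\xi(A)$ have the same diagonal sum (so $A$ is the pattern of an RCDS doubly stochastic matrix); and every doubly stochastic matrix $X$ with $\xi(X)=\xi(A)$ all of whose diagonals avoiding $\xi(A)$ have the same sum equals this $X(x)$.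
   Context: A square nonnegative matrix is doubly stochastic if all row and column sums equal $1$. $\xi(M)$ denotes the set of positions of the zero entries of a matrix $M$. For a permutation $\sigma$ of $\{1,\ldots,n\}$, the diagonal corresponding to $\sigma$ is the set of positions $(i,\sigma(i))$, with diagonal sum $\sum_i x_{i,\sigma(i)}$; it avoids $\xi(A)$ if no position $(i,\sigma(i))$ lies in $\xi(A)$. *)

(* Defs.v *)
From HB Require Import structures.
From mathcomp Require Import all_boot all_order all_fingroup all_algebra.

Set Implicit Arguments.
Unset Strict Implicit.
Unset Printing Implicit Defensive.

Import Order.TTheory GRing.Theory Num.Theory.
Local Open Scope ring_scope.

(* Indices of matrices and vectors are 0-based: the entry (i, j) of the usual
   1-based notation is the entry (i - 1, j - 1) here. *)

Definition doubly_stochastic (R : numDomainType) (n : nat) (M : 'M[R]_n) : Prop :=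
  [/\ forall i j, 0 <= M i j,
      forall i, \sum_j M i j = 1
    & forall j, \sum_i M i j = 1].

Definition xi (R : nzRingType) (n : nat) (M : 'M[R]_n) : {set 'I_n * 'I_n} :=
  [set p | M p.1 p.2 == 0].

Definition pattern (R : nzRingType) (n : nat) (M : 'M[R]_n) : 'M[R]_n :=
  \matrix_(i, j) (M i j != 0)%:R.

Definition diagonal (n : nat) (s : 'S_n) : {set 'I_n * 'I_n} :=
  [set (i, s i) | i : 'I_n].

Definition diagonal_sum (R : nzRingType) (n : nat) (M : 'M[R]_n) (s : 'S_n) : R :=
  \sum_i M i (s i).

Definition avoids (n : nat) (s : 'S_n) (Z : {set 'I_n * 'I_n}) : bool :=
  [disjoint diagonal s & Z].

Definition common_diagonal_sum (R : nzRingType) (n : nat)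
    (Z : {set 'I_n * 'I_n}) (M : 'M[R]_n) : Prop :=
  forall s t : 'S_n, avoids s Z -> avoids t Z ->
    diagonal_sum M s = diagonal_sum M t.

(* Restricted common diagonal sum property: all the diagonals of M that avoid
   the zeros of M itself have the same sum. *)
Definition RCDS (R : nzRingType) (n : nat) (M : 'M[R]_n) : Prop :=
  common_diagonal_sum (xi M) M.

Definition tridiag01 (R : nzRingType) (n : nat) : 'M[R]_n :=
  \matrix_(i, j) (`|(i : nat)%:Z - (j : nat)%:Z| <= 1)%:R.

(* [coordz x k] is the 1-based coordinate x_k of x = (x_1, ..., x_(n-1)),
   with value 0 outside 1 <= k <= n - 1; in particular x_0 = x_n = 0. *)
Definition coordz (R : nzRingType) (m : nat) (x : 'rV[R]_m) (k : nat) : R :=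
  if k is k'.+1 then oapp (fun i : 'I_m => x 0 i) 0 (insub k') else 0.

Definition tridiag_system (R : nzRingType) (n : nat) (x : 'rV[R]_n.-1) : Prop :=
  forall k : nat, (1 <= k <= n.-1)%N ->
    coordz x k.-1 + 4 * coordz x k + coordz x k.+1 = 2.

(* The 0-based index i stands for the 1-based index i + 1: hence the diagonal
   entry 1 - x_i - x_(i+1), and x_(i+1) at the positions (i, i + 1), (i + 1, i). *)
Definition Xmx (R : nzRingType) (n : nat) (x : 'rV[R]_n.-1) : 'M[R]_n :=
  \matrix_(i, j)
    if i == j :> nat then 1 - coordz x i - coordz x i.+1
    else if j == i.+1 :> nat then coordz x i.+1
    else if i == j.+1 :> nat then coordz x j.+1
    else 0.

(* Main.v *)
Require Import Defs.
From HB Require Import structures.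
From mathcomp Require Import all_boot all_order all_fingroup all_algebra.
From mathcomp Require Import zify ring lra.

Set Implicit Arguments.
Unset Strict Implicit.
Unset Printing Implicit Defensive.

Import Order.TTheory GRing.Theory Num.Theory.
Local Open Scope ring_scope.

(** The recurrence d_(k-1) + 4 d_k + d_(k+1) = 0 obeys a maximum principle,
    since at an interior maximum of |d| one gets 4 |d| <= 2 |d|. It yields
    uniqueness for the system, hence existence by shooting, and, applied to
    d = x - 1/3, the bounds 1/6 <= x_k <= 1/2 that make X(x) nonnegative with
    the right zero pattern.

    The system says exactly that each off-diagonal entry (k, k+1) of X(x) is the
    mean of the diagonal entries k and k+1. Hence every entry (i, j) in the
    pattern is u_i + u_j, where u_i is half of the i-th diagonal entry, and every
    diagonal in the pattern has sum 2 * \sum_i u_i, the trace.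

    Conversely, comparing row and column sums shows that a tridiagonal doubly
    stochastic matrix is symmetric, thus of the form X(y), and comparing the
    identity with the transposition of k and k+1 shows that y solves the system. *)

(** * The recurrence: maximum principle, uniqueness and bounds *)

Section Recurrence.
Variables (R : realFieldType) (n : nat).
Implicit Types d c : nat -> R.

Lemma recurrence_max_principle d (B : R) :
    (forall k, (0 < k < n)%N -> d k.-1 + 4 * d k + d k.+1 = 0) ->
    `|d 0| <= B -> `|d n| <= B ->
  forall k, (k <= n)%N -> `|d k| <= B.
Proof.
move=> dE d0 dn k kn.
pose F (i : 'I_n.+1) := `|d i|.
have [m _ mmax] := @arg_maxP _ _ _ (ord0 : 'I_n.+1) xpredT F isT.
have max_m j : (j <= n)%N -> `|d j| <= `|d m|.
  by move=> jn; have := mmax (inord j) isT; rewrite /F inordK.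
apply: le_trans (max_m _ kn) _.
have [m0|m0] := posnP m; first by rewrite m0.
have [mn|mn] := eqVneq (m : nat) n; first by rewrite mn.
have lt_mn : (m < n)%N by rewrite ltn_neqAle mn -ltnS ltn_ord.
have {}dE := dE m; rewrite m0 lt_mn in dE; have {}dE := dE isT.
have le4 : 4 * `|d m| <= `|d m.-1| + `|d m.+1|.
  have -> : 4 * `|d m| = `|d m.-1 + d m.+1|.
    have -> : d m.-1 + d m.+1 = - (4 * d m) by lra.
    by rewrite normrN normrM ger0_norm // ler0n.
  exact: ler_normD.
have l1 : `|d m.-1| <= `|d m| by apply: max_m; lia.
have l2 : `|d m.+1| <= `|d m| by apply: max_m.
(* Now [4 * |d m| <= 2 * |d m|] forces [|d m| <= 0], while [0 <= |d 0| <= B]. *)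
by have := normr_ge0 (d 0); lra.
Qed.

Lemma recurrence_eq c d :
    c 0%N = d 0%N -> c n = d n ->
    (forall k, (0 < k < n)%N -> c k.-1 + 4 * c k + c k.+1 = 2) ->
    (forall k, (0 < k < n)%N -> d k.-1 + 4 * d k + d k.+1 = 2) ->
  forall k, (k <= n)%N -> c k = d k.
Proof.
move=> e0 en cE dE k kn; apply/subr0_eq/normr0_eq0/le_anti.
rewrite normr_ge0 andbT.
apply: (@recurrence_max_principle (fun k => c k - d k)) => //=.
- by move=> j jn; have := cE j jn; have := dE j jn; lra.
- by rewrite e0 subrr normr0.
- by rewrite en subrr normr0.
Qed.

(** The constant 1/3 solves the recurrence, so the maximum principle puts every [c k] in [0, 2/3].
    Feeding this for both neighbours into [4 * c k = 2 - c k.-1 - c k.+1] sharpens it to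
    [1/6, 1/2]. *)
Lemma recurrence_bounds c :
    c 0%N = 0 -> c n = 0 ->
    (forall k, (0 < k < n)%N -> c k.-1 + 4 * c k + c k.+1 = 2) ->
  forall k, (0 < k < n)%N -> 1 / 6 <= c k <= 1 / 2.
Proof.
move=> c0 cn cE.
have bnd k : (k <= n)%N -> `|c k - 1 / 3| <= 1 / 3.
  apply: (@recurrence_max_principle (fun k => c k - 1 / 3)) => /=.
  - by move=> j jn; have := cE j jn; lra.
  - by rewrite c0 ler_norml; lra.
  - by rewrite cn ler_norml; lra.
move=> k kn; have := cE k kn.
have /bnd : (k.-1 <= n)%N by lia.
have /bnd : (k.+1 <= n)%N by lia.
by rewrite !ler_norml; lra.
Qed.

End Recurrence.

(** * Existence by shooting from the left end *)

Fixpoint recseq_pair (R : realFieldType) (b s : R) (k : nat) : R * R :=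
  if k is k'.+1 then
    let: (u, v) := recseq_pair b s k' in (v, b - 4 * v - u)
  else (0, s).

Definition recseq (R : realFieldType) (b s : R) (k : nat) : R :=
  (recseq_pair b s k).1.

Lemma recseqE (R : realFieldType) (b s : R) (k : nat) : (0 < k)%N ->
  recseq b s k.-1 + 4 * recseq b s k + recseq b s k.+1 = b.
Proof.
rewrite /recseq; case: k => [|k] //= _.
by case: (recseq_pair b s k) => u v /=; ring.
Qed.

Lemma recurrence_solution (R : realFieldType) (n : nat) : (0 < n)%N ->
  exists c : nat -> R, [/\ c 0%N = 0, c n = 0
    & forall k, (0 < k < n)%N -> c k.-1 + 4 * c k + c k.+1 = 2].
Proof.
move=> n0.
pose p := recseq (2 : R) 0; pose h := recseq (0 : R) 1.
(* If [h] vanished at both ends, the maximum principle would kill it, but [h 1 = 1]. *)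
have hn : h n != 0.
  apply/eqP => hn.
  have hE k : (0 < k < n)%N -> h k.-1 + 4 * h k + h k.+1 = 0.
    by case/andP=> k0 _; apply: recseqE.
  have := @recurrence_max_principle R n h 0 hE.
  rewrite hn normr0 => /(_ (lexx _) (lexx _) 1%N n0).
  by rewrite /h /recseq /= normr1 ler10.
(* Both [p] and [h] start at 0; the multiple of [h] is chosen to cancel [p n]. *)
exists (fun k => p k - p n / h n * h k); split.
- by rewrite mulr0 subrr.
- by rewrite mulfVK // subrr.
move=> k /andP[k0 _]; have := recseqE (2 : R) 0 k0; have := recseqE (0 : R) 1 k0.
rewrite -/p -/h.
set a := p n / h n => e1 e2.
transitivity ((p k.-1 + 4 * p k + p k.+1) - a * (h k.-1 + 4 * h k + h k.+1)).
  by ring.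
by rewrite e1 e2; ring.
Qed.

(** * Row vectors as sequences vanishing at 0 and [n] *)

Section Coordinates.
Variables (R : realFieldType) (n : nat).
Implicit Types x : 'rV[R]_n.-1.

Lemma coordz_ord x (i : 'I_n.-1) : coordz x i.+1 = x 0 i.
Proof. by rewrite /= valK. Qed.

Lemma coordz_out x k : (n <= k)%N -> coordz x k = 0.
Proof. by case: k => //= k nk; rewrite insubN //; lia. Qed.

Lemma coordz_row (c : nat -> R) k : c 0%N = 0 -> c n = 0 -> (k <= n)%N ->
  coordz (\row_(i < n.-1) c i.+1) k = c k.
Proof.
move=> c0 cn; case: k => [|k] //= kn.
case: insubP => [i _ <-|nk] /=; first by rewrite mxE.
(* The index is out of range only at the right end, where the default 0 agrees with [c n]. *)
by suff -> : k.+1 = n by []; lia.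
Qed.

Lemma tridiag_systemE x : tridiag_system x <->
  forall k, (0 < k < n)%N ->
    coordz x k.-1 + 4 * coordz x k + coordz x k.+1 = 2.
Proof. by split=> H k kn; apply: H; lia. Qed.

Lemma coordz_inj x y :
  (forall k, (k <= n)%N -> coordz x k = coordz y k) -> x = y.
Proof.
move=> e; apply/rowP => i; rewrite -!coordz_ord; apply: e.
by have := ltn_ord i; lia.
Qed.

Lemma tridiag_system_uniq x y : (0 < n)%N ->
  tridiag_system x -> tridiag_system y -> x = y.
Proof.
move=> n0 /tridiag_systemE xE /tridiag_systemE yE.
apply: coordz_inj; apply: recurrence_eq => //.
by rewrite !coordz_out.
Qed.

Lemma tridiag_system_solvable : (0 < n)%N ->
  exists x : 'rV[R]_n.-1, tridiag_system x.
Proof.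
move=> n0; have [c [c0 cn cE]] := recurrence_solution R n0.
exists (\row_(i < n.-1) c i.+1); apply/tridiag_systemE => k kn.
by rewrite !coordz_row //; [apply: cE | lia..].
Qed.

End Coordinates.

(** * Tridiagonal matrices and the entries of X(x) *)

Definition near (i j : nat) := (i <= j.+1)%N && (j <= i.+1)%N.

Section Tridiagonal.
Variables (R : realFieldType) (n : nat).
Implicit Types (M : 'M[R]_n) (x : 'rV[R]_n.-1).

Lemma tridiag01E (i j : 'I_n) : tridiag01 R n i j = (near i j)%:R.
Proof. by rewrite mxE /near; congr (nat_of_bool _)%:R; lia. Qed.

Lemma xi_tridiag01E (i j : 'I_n) :
  ((i, j) \in xi (tridiag01 R n)) = ~~ near i j.
Proof. by rewrite inE /= tridiag01E pnatr_eq0 eqb0. Qed.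

Lemma avoids_tridiag01P (s : 'S_n) :
  reflect (forall i : 'I_n, near i (s i)) (avoids s (xi (tridiag01 R n))).
Proof.
rewrite /avoids disjoint_subset.
apply: (iffP subsetP) => [sub i | nr _ /imsetP[i _ ->]].
  have := sub (i, s i); rewrite inE xi_tridiag01E negbK; apply.
  exact/imsetP/(ex_intro2 _ _ i).
by rewrite inE xi_tridiag01E negbK.
Qed.

(** Taking [g] on all of [nat] with [g n = 0] lets the last row, whose right neighbour is missing,
    follow the same formula as the inner rows. *)
Lemma sum_near (g : nat -> R) i : (i < n)%N ->
    (forall j, (j < n)%N -> ~~ near i j -> g j = 0) -> g n = 0 ->
  \sum_(j < n) g j = (if i is i'.+1 then g i' else 0) + g i + g i.+1.
Proof.
move=> lt_in g0 gn.
have delta k : (k <= n)%N -> \sum_(j < n) (if j == k :> nat then g k else 0) = g k.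
  rewrite leq_eqVlt => /predU1P[->|kn].
    by rewrite gn big1 // => j _; rewrite if_same.
  rewrite (bigD1 (Ordinal kn)) //= eqxx big1 ?addr0 // => j jk.
  by rewrite ifN.
(* Split [g] into three functions, each supported at a single index. *)
transitivity (\sum_(j < n)
    ((if i is i'.+1 then if j == i' :> nat then g i' else 0 else 0)
     + (if j == i :> nat then g i else 0)
     + (if j == i.+1 :> nat then g i.+1 else 0))).
  apply: eq_bigr => j _; have lt_jn := ltn_ord j.
  case: i lt_in g0 => [|i] lt_in g0; do ! case: eqP => ?;
    try (exfalso; lia); rewrite ?add0r ?addr0;
    by [congr g; lia | apply: g0 => //; rewrite /near; lia].
rewrite !big_split /= !delta //; last exact: ltnW.
case: i lt_in {g0} => [|i] lt_in; first by rewrite big1.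
by rewrite delta // ltnW // ltnW.
Qed.

Definition tri (c : nat -> R) (i j : nat) : R :=
  if i == j then 1 - c i - c i.+1
  else if j == i.+1 then c i.+1
  else if i == j.+1 then c j.+1
  else 0.

Lemma XmxE x (i j : 'I_n) : Xmx x i j = tri (coordz x) i j.
Proof. by rewrite mxE. Qed.

Lemma triC c i j : tri c i j = tri c j i.
Proof.
rewrite /tri; do ! case: eqP => ? //; try (exfalso; lia).
by congr (_ - c _ - c _.+1).
Qed.

Lemma tri_far c i j : ~~ near i j -> tri c i j = 0.
Proof.
by rewrite /near /tri => ?; do ! case: eqP => ? //; exfalso; lia.
Qed.

Lemma sum_tri c i : c 0%N = 0 -> c n = 0 -> (i < n)%N ->
  \sum_(j < n) tri c i j = 1.
Proof.
move=> c0 cn lt_in; rewrite (@sum_near (tri c i) i) //.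
- rewrite /tri eqxx; case: i lt_in => [|i] _.
    by rewrite c0 /=; ring.
  rewrite !eqxx !ifN_eq; [ring | lia..].
- by move=> j _; apply: tri_far.
- rewrite /tri ifN_eq; last by lia.
  by case: eqP => [<- //|_]; rewrite ifN_eq //; lia.
Qed.

Lemma Xmx_gt0 x (i j : 'I_n) : tridiag_system x -> near i j -> 0 < Xmx x i j.
Proof.
move=> /tridiag_systemE xE; have cn := coordz_out x (leqnn n).
have bnd := recurrence_bounds (erefl : coordz x 0 = 0) cn xE.
rewrite XmxE /near /tri; set c := coordz x in cn bnd xE *.
have [lt_in lt_jn] := (ltn_ord i, ltn_ord j).
have pos k : (0 < k < n)%N -> 0 < c k by move/bnd; lra.
case: eqP => [_|ij] nij.
  suff : c i + c i.+1 < 1 by lra.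
  have c0 : c 0%N = 0 by [].
  case: (posnP i) => [->|i0].
    rewrite c0; case: (ltnP 1 n) => [n1|n1].
      by have := bnd 1%N; rewrite n1 => /(_ isT); lra.
    by rewrite (_ : 1%N = n) ?cn; [lra | lia].
  have := bnd i; rewrite i0 lt_in => /(_ isT) bi.
  case: (ltnP i.+1 n) => [n1|n1]; last first.
    by rewrite (_ : i.+1 = n) ?cn; [lra | lia].
  (* The bounds 1/2 only give [c i + c i.+1 <= 1]. Strictness comes from adding two consecutive
     equations: [5 * (c i + c i.+1) = 4 - c i.-1 - c i.+2 <= 4]. *)
  have e1 : c i.-1 + 4 * c i + c i.+1 = 2 by apply: xE; lia.
  have := bnd i.+1; rewrite n1 => /(_ isT) bi1.
  have e2 : c i + 4 * c i.+1 + c i.+2 = 2 by apply: (xE i.+1).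
  have p1 : 0 <= c i.-1.
    case: (posnP i.-1) => [->|i1]; first by rewrite c0.
    by apply/ltW/pos; lia.
  have p2 : 0 <= c i.+2.
    case: (ltnP i.+2 n) => [i2|i2]; first by apply/ltW/pos.
    by rewrite (_ : i.+2 = n) ?cn //; lia.
  lra.
by do ! case: eqP => ?; try (exfalso; lia); apply: pos; lia.
Qed.

Lemma doubly_stochastic_Xmx x : tridiag_system x -> doubly_stochastic (Xmx x).
Proof.
move=> xS; have cn := coordz_out x (leqnn n); split.
- move=> i j; have [/(Xmx_gt0 xS)/ltW//|nij] := boolP (near i j).
  by rewrite XmxE tri_far.
- by move=> i; under eq_bigr do rewrite XmxE; apply: sum_tri.
- by move=> i; under eq_bigr do rewrite XmxE triC; apply: sum_tri.
Qed.

Lemma xi_Xmx x : tridiag_system x -> xi (Xmx x) = xi (tridiag01 R n).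
Proof.
move=> xS; apply/setP => -[i j]; rewrite xi_tridiag01E inE /=.
have [/(Xmx_gt0 xS) gt0|nij] := boolP (near i j); first by rewrite gt_eqF.
by rewrite XmxE tri_far // eqxx.
Qed.

(** * Diagonal sums over the pattern *)

Lemma diagonal_sum_potential M (u v : 'I_n -> R) (s : 'S_n) :
    (forall i, M i (s i) = u i + v (s i)) ->
  diagonal_sum M s = \sum_i u i + \sum_i v i.
Proof.
move=> Ms; rewrite /diagonal_sum (eq_bigr _ (fun i _ => Ms i)) big_split /=.
by congr (_ + _); rewrite [RHS](reindex_inj (@perm_inj _ s)).
Qed.

Lemma common_diagonal_sum_Xmx x :
  tridiag_system x -> common_diagonal_sum (xi (tridiag01 R n)) (Xmx x).
Proof.
move=> /tridiag_systemE xE s t.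
pose u (i : 'I_n) := (1 - coordz x i - coordz x i.+1) / 2.
have potential (i j : 'I_n) : near i j -> Xmx x i j = u i + u j.
  have [lt_in lt_jn] := (ltn_ord i, ltn_ord j).
  rewrite XmxE /near /tri /u => nij.
  case: eqP => [<-|?]; first by field.
  case: eqP => [ji|?].
    by rewrite ji; have := xE i.+1; rewrite -ji lt_jn ji => /(_ isT) /=; lra.
  case: eqP => [ij|?]; last by exfalso; lia.
  by rewrite ij; have := xE j.+1; rewrite -ij lt_in ij => /(_ isT) /=; lra.
move=> /avoids_tridiag01P sA /avoids_tridiag01P tA.
by rewrite !(@diagonal_sum_potential _ u u) // => i; apply: potential.
Qed.

(** The two diagonals differ only in rows [i] and [j]. *)
Lemma diagonal_sum_tperm M (i j : 'I_n) : i != j ->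
  diagonal_sum M (tperm i j) + (M i i + M j j)
    = diagonal_sum M 1%g + (M i j + M j i).
Proof.
move=> ij.
have sumD s : diagonal_sum M s = M i (s i) +
    (M j (s j) + \sum_(k < n | (k != i) && (k != j)) M k (s k)).
  by rewrite /diagonal_sum (bigD1 i) //= (bigD1 j) // eq_sym.
rewrite !sumD !perm1 tpermL tpermR.
rewrite [in LHS](eq_bigr (fun k => M k ((1 : 'S_n)%g k))); last first.
  by move=> k /andP[ki kj]; rewrite perm1 tpermD // eq_sym.
by set S := \sum_(k < n | _) _; ring.
Qed.

Lemma tridiag_system_of_common_sum x :
  common_diagonal_sum (xi (tridiag01 R n)) (Xmx x) -> tridiag_system x.
Proof.
move=> xC; apply/tridiag_systemE => -[|k] //= lt_kn.
pose i := Ordinal (ltnW lt_kn); pose j := Ordinal lt_kn.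
have ij : i != j by rewrite -val_eqE /=; lia.
have eq_sum : diagonal_sum (Xmx x) (tperm i j) = diagonal_sum (Xmx x) 1%g.
  apply: xC; apply/avoids_tridiag01P => l; rewrite /near.
    by case: tpermP => [->|->|_ _] /=; lia.
  by rewrite perm1; lia.
have := diagonal_sum_tperm (Xmx x) ij.
rewrite eq_sum !XmxE /tri /= !eqxx !ifN_eq; try lia.
(* Cancelling the common sum leaves [(1 - x_k - x_(k+1)) + (1 - x_(k+1) - x_(k+2)) = 2 x_(k+1)],
   which is equation k+1 of the system. *)
by move=> /addrI; lra.
Qed.

(** Extension by zero, which supplies the vanishing value at index [n] that [sum_near] asks for. *)
Definition mx_ext M (i j : nat) : R :=
  if insub i is Some a then if insub j is Some b then M a b else 0 else 0.

Lemma mx_extE M (i j : 'I_n) : mx_ext M i j = M i j.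
Proof. by rewrite /mx_ext !valK. Qed.

Lemma tridiag_doubly_stochasticE M : doubly_stochastic M ->
    (forall i j : 'I_n, ~~ near i j -> M i j = 0) ->
  exists y : 'rV[R]_n.-1, M = Xmx y.
Proof.
move=> [_ rowM colM] farM; pose f := mx_ext M.
have f_nl j : f n j = 0 by rewrite /f /mx_ext insubN // ltnn.
have f_nr i : f i n = 0.
  by rewrite /f /mx_ext; case: insub => // a; rewrite insubN // ltnn.
have f_far i j : (i < n)%N -> (j < n)%N -> ~~ near i j -> f i j = 0.
  by move=> li lj; have := farM (Ordinal li) (Ordinal lj); rewrite -mx_extE.
have rowf i : (i < n)%N ->
    (if i is i'.+1 then f i i' else 0) + f i i + f i i.+1 = 1.
  move=> li; rewrite -(@sum_near (f i) i) // => [|j lj]; last exact: f_far.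
  by rewrite -(rowM (Ordinal li)); apply: eq_bigr => j _; rewrite -mx_extE.
have colf i : (i < n)%N ->
    (if i is i'.+1 then f i' i else 0) + f i i + f i.+1 i = 1.
  move=> li; rewrite -(@sum_near (f^~ i) i) // => [|j lj nij]; last first.
    by apply: f_far; rewrite // /near andbC.
  by rewrite -(colM (Ordinal li)); apply: eq_bigr => j _; rewrite -mx_extE.
(* Row [k] and column [k] share the diagonal entry and, by induction, have equal entries before it,
   so the entries after it agree too. *)
have symf k : (k < n)%N -> f k k.+1 = f k.+1 k.
  elim: k => [|k IHk] lk; have := rowf _ lk; have := colf _ lk; first by lra.
  by rewrite IHk; [lra | exact: ltnW].
(* The vector [y] is the superdiagonal of [M]; the row sums then determine the diagonal. *)
pose c k := if k is k'.+1 then f k' k'.+1 else 0.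
have cn : c n = 0 by rewrite /c; case: (n) f_nr.
exists (\row_(k < n.-1) c k.+1); apply/matrixP => i j.
have [lt_in lt_jn] := (ltn_ord i, ltn_ord j).
rewrite XmxE -mx_extE -/f /tri !coordz_row //; try exact: ltnW.
case: eqP => [<-|ij].
  have := rowf i lt_in; rewrite /c.
  case: (nat_of_ord i) lt_in => [|k] lk; first by lra.
  by rewrite -symf; [lra | exact: ltnW].
case: eqP => [->//|ij1].
case: eqP => [->|ij2]; first by rewrite /c symf.
by rewrite f_far // /near; lia.
Qed.

End Tridiagonal.

Theorem theorem4p2 (R : realFieldType) (n : nat) (n_ge2 : (2 <= n)%N) :
  (exists! x : 'rV[R]_n.-1, tridiag_system x) /\
  (forall x : 'rV[R]_n.-1, tridiag_system x ->
    [/\ doubly_stochastic (Xmx x),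
        xi (Xmx x) = xi (tridiag01 R n),
        common_diagonal_sum (xi (tridiag01 R n)) (Xmx x),
        (exists M : 'M[R]_n,
           [/\ doubly_stochastic M, RCDS M & pattern M = tridiag01 R n])
      & forall M : 'M[R]_n,
          doubly_stochastic M ->
          xi M = xi (tridiag01 R n) ->
          common_diagonal_sum (xi (tridiag01 R n)) M ->
          M = Xmx x]).
Proof.
have n0 : (0 < n)%N by apply: ltnW.
split.
  have [x xS] := tridiag_system_solvable R n0.
  by exists x; split=> // y; apply: tridiag_system_uniq.
move=> x xS.
have xDS := doubly_stochastic_Xmx xS.
have xX := xi_Xmx xS.
have xC := common_diagonal_sum_Xmx xS.
split=> //.
  exists (Xmx x); split=> //; first by rewrite /RCDS xX.
  apply/matrixP => i j; have := xi_tridiag01E R i j.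
  by rewrite -xX inE tridiag01E [pattern _ _ _]mxE => ->; rewrite negbK.
move=> M MDS MX MC.
have [|y My] := tridiag_doubly_stochasticE MDS.
  by move=> i j; rewrite -(xi_tridiag01E R) -MX inE => /eqP.
rewrite My in MC *; congr Xmx; apply: tridiag_system_uniq => //.
exact: tridiag_system_of_common_sum.
Qed.
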